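(* Let $\mathcal{X}=\mathbb{R}^n$, let $Q=Q^T$ and $J=-J^T$ be real $n\times n$ matrices, let $G$ be a full-rank real $n\times k$ matrix, let $\Lambda=\mathbb{R}^k$, and let $\mathcal{D}\subset\mathcal{X}\times\mathcal{X}^*$ be the Dirac structure consisting of all $(f,e)$ for which there exists $\lambda\in\Lambda$ with $$-f=Je+G\lambda,\qquad 0=G^Te.$$ Consider the port-Hamiltonian DAE system $(-\dot{x},Qx)\in\mathcal{D}$ with Hamiltonian $H(x)=\frac12x^TQx$, and the extended DAE system in $(x,\lambda)\in\mathcal{X}\times\Lambda$ $$\begin{bmatrix} I&0\\0&0\end{bmatrix}\begin{bmatrix}\dot{x}\\ \dot{\lambda}\end{bmatrix}=\begin{bmatrix} J&G\\-G^T&0\end{bmatrix}\begin{bmatrix} Q&0\\0&I\end{bmatrix}\begin{bmatrix} x\\ \lambda\end{bmatrix}.$$ Then any solution $(x(\cdot),\lambda(\cdot))$ of the extended system projects to a solution $x(\cdot)$ of the original port-Hamiltonian DAE system, and conversely any solution $x(\cdot)$ of the original port-Hamiltonian DAE system is the projection of a solution $(x(\cdot),\lambda(\cdot))$ of the extended system.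
   Context: Elements of $\mathcal{X}=\mathbb{R}^n$ and $\mathcal{X}^*$ are column vectors with duality product $\langle e\mid f\rangle=e^Tf$. A Dirac structure is a subspace $\mathcal{D}\subset\mathcal{X}\times\mathcal{X}^*$ that equals its orthogonal companion with respect to the bilinear form $\langle(f_1,e_1),(f_2,e_2)\rangle_+:=\langle e_1\mid f_2\rangle+\langle e_2\mid f_1\rangle$; subspaces of the form given in the claim are Dirac structures. A solution of the port-Hamiltonian DAE system is a differentiable function $x(\cdot)$ on a time interval with $(-\dot{x}(t),Qx(t))\in\mathcal{D}$ for all $t$. The extended DAE system is understood as the equations $\dot{x}=JQx+G\lambda$, $0=-G^TQx$; as the derivative $\dot{\lambda}$ is multiplied by zero, it does not enter, and a solution is a pair of functions $(x(\cdot),\lambda(\cdot))$ on a time interval, with $x(\cdot)$ differentiable and no differentiability required of $\lambda(\cdot)$, satisfying these equations for all $t$. Projection means $(x(\cdot),\lambda(\cdot))\mapsto x(\cdot)$. *)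

(* Defs.v *)
From HB Require Import structures.
From mathcomp Require Import all_boot all_order all_algebra.
From mathcomp Require Import all_classical all_reals all_analysis.
From mathcomp Require Import ring.

Set Implicit Arguments.
Unset Strict Implicit.
Unset Printing Implicit Defensive.

Import Order.TTheory GRing.Theory Num.Theory.
Import numFieldNormedType.Exports.

Local Open Scope classical_set_scope.
Local Open Scope ring_scope.

Section DerivativeWithin.
Variables (R : realType) (V : normedModType R).
Implicit Types (I : interval R) (f : R -> V) (t : R).

(* Same difference quotient as [derivable] and [derive1], except that the
   increment [h] keeps [h + t] inside [I]: this is the usual derivative at
   interior points of [I] (see [derivable_withinE], [derive_withinE]) and the
   one-sided derivative at an endpoint belonging to [I].  Values of [f]
   outside [I] are irrelevant. *)
Definition derivable_within I f t : Prop :=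
  cvg ((fun h => h^-1 *: (f (h + t) - f t)) @
         within [set h | h + t \in I] 0^').

Definition derive_within I f t : V :=
  lim ((fun h => h^-1 *: (f (h + t) - f t)) @
         within [set h | h + t \in I] 0^').

Lemma within_interior I t : [set` I]° t ->
  within [set h | h + t \in I] (0 : R)^' = 0^'.
Proof.
move=> It; have nI : (0 : R)^' [set h | h + t \in I].
  apply: nbhs_dnbhs.
  have tC : h + t @[h --> (0 : R)] --> t.
    rewrite -[X in _ --> X]add0r; apply: cvgD; [exact: cvg_id | exact: cvg_cst].
  exact: tC It.
apply/seteqP; split=> A; last exact: cvg_within.
by rewrite /within /= => IA; apply: filterS2 nI IA => h Ih; apply.
Qed.

Lemma derivable_withinE I f t : [set` I]° t ->
  derivable_within I f t <-> derivable f t 1.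
Proof.
move=> It; rewrite /derivable_within within_interior // /derivable.
suff -> : (fun h : R => h^-1 *: (f (h + t) - f t)) =
          (fun h : R => h^-1 *: ((f \o shift t) (h *: 1) - f t)) by [].
by apply/funext => h /=; rewrite [h *: 1]mulr1.
Qed.

Lemma derive_withinE I f t : [set` I]° t -> derive_within I f t = derive1 f t.
Proof. by move=> It; rewrite /derive_within within_interior. Qed.

End DerivativeWithin.

Section Dirac.
Variables (R : realType) (n : nat).
Implicit Types D : set ('cV[R]_n * 'cV[R]_n).

Definition duality (e f : 'cV[R]_n) : R := (e^T *m f) 0 0.

(* Pairs are [(f, e)], with the [X]-component first. *)
Definition plus_form (u v : 'cV[R]_n * 'cV[R]_n) : R :=
  duality u.2 v.1 + duality v.2 u.1.

Definition orth_companion D : set ('cV[R]_n * 'cV[R]_n) :=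
  [set u | forall v, D v -> plus_form u v = 0].

Definition is_subspace D : Prop :=
  D 0 /\ forall (a : R) u v, D u -> D v -> D (a *: u + v).

Definition is_dirac D : Prop := is_subspace D /\ D = orth_companion D.

Lemma dualityC (e f : 'cV[R]_n) : duality e f = duality f e.
Proof. by rewrite /duality -[in RHS](trmxK e) -trmx_mul [RHS]mxE. Qed.

Lemma dualityDr (e f g : 'cV[R]_n) :
  duality e (f + g) = duality e f + duality e g.
Proof. by rewrite /duality mulmxDr mxE. Qed.

Lemma dualityNr (e f : 'cV[R]_n) : duality e (- f) = - duality e f.
Proof. by rewrite /duality mulmxN mxE. Qed.

Lemma duality0r (e : 'cV[R]_n) : duality e 0 = 0.
Proof. by rewrite /duality mulmx0 mxE. Qed.

End Dirac.

Lemma duality_trmx (R : realType) (n k : nat) (A : 'M[R]_(n, k)) e f :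
  duality e (A *m f) = duality (A^T *m e) f.
Proof. by rewrite /duality trmx_mul trmxK mulmxA. Qed.

Lemma duality_eq0 (R : realType) (n : nat) (e : 'cV[R]_n) :
  (forall f, duality e f = 0) -> e = 0.
Proof.
move=> e0; apply/matrixP => i j; rewrite [j]ord1 mxE.
by have := e0 (delta_mx i 0); rewrite /duality -colE !mxE.
Qed.

Section PortHamiltonian.
Variables (R : realType) (n k : nat).
Implicit Types (Q J : 'M[R]_n) (G : 'M[R]_(n, k)) (I : interval R).
Implicit Types (x : R -> 'cV[R]_n) (lambda : R -> 'cV[R]_k).

Definition constraint_dirac J G : set ('cV[R]_n * 'cV[R]_n) :=
  [set fe | exists lambda : 'cV[R]_k,
      - fe.1 = J *m fe.2 + G *m lambda /\ 0 = G^T *m fe.2].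

Lemma constraint_dirac_is_dirac J G : J = - J^T ->
  is_dirac (constraint_dirac J G).
Proof.
move=> Jskew; split.
  split; first by exists 0; rewrite /= !mulmx0 oppr0 addr0.
  move=> a u v [l [lu eu]] [m [mv ev]]; exists (a *: l + m); split => /=.
    rewrite opprD -scalerN lu mv !mulmxDr -!scalemxAr scalerDr.
    by rewrite addrACA.
  by rewrite mulmxDr -scalemxAr -eu -ev scaler0 addr0.
have JE e e' : duality e (J *m e') = - duality e' (J *m e).
  have JT : J^T = - J by rewrite {2}Jskew opprK.
  by rewrite duality_trmx dualityC JT mulNmx dualityNr.
have dG e l : 0 = G^T *m e -> duality e (G *m l) = 0.
  by move=> Ge; rewrite duality_trmx -Ge dualityC duality0r.
apply/seteqP; split=> [[f e] [l /= [fE eE]] [f' e'] [l' /= [fE' eE']]|[f e] fe].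
  rewrite /plus_form /= -[f]opprK -[f']opprK fE fE'.
  by rewrite !dualityNr !dualityDr !dG // !addr0 JE opprK subrr.
have Ge : G^T *m e = 0.
  apply: duality_eq0 => l; rewrite -duality_trmx.
  have : plus_form (f, e) (- (G *m l), 0) = 0.
    by apply: fe; exists l; rewrite /= opprK !mulmx0 add0r.
  rewrite /plus_form /= dualityNr [duality 0 _]dualityC duality0r addr0.
  by move/eqP; rewrite oppr_eq0 => /eqP.
have fJe e' : G^T *m e' = 0 -> duality e' (- f - J *m e) = 0.
  move=> Ge'; have : plus_form (f, e) (- (J *m e'), e') = 0.
    by apply: fe; exists 0; rewrite /= opprK mulmx0 addr0.
  rewrite /plus_form /= dualityNr JE opprK => fe0.
  by rewrite dualityDr !dualityNr addrC -opprD fe0 oppr0.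
have : ((- f - J *m e)^T <= G^T)%MS.
  rewrite submxE; apply/eqP/trmx_inj; rewrite trmx0 trmx_mul trmxK.
  apply: duality_eq0 => u; rewrite dualityC duality_trmx trmxK.
  by apply: fJe; rewrite mulmxA mulmx_coker mul0mx.
case/submxP => l /(congr1 trmx); rewrite trmxK trmx_mul trmxK => lE.
by exists l^T; split; rewrite /= ?Ge // -lE addrC subrK.
Qed.

Definition hamiltonian Q (x : 'cV[R]_n) : R := 2^-1 * duality x (Q *m x).

(* [Q *m x] is the gradient of the Hamiltonian at [x], since the last term is
   quadratic in [v]. *)
Lemma hamiltonianD Q (x v : 'cV[R]_n) : Q = Q^T ->
  hamiltonian Q (x + v) = hamiltonian Q x + duality (Q *m x) v + hamiltonian Q v.
Proof.
move=> Qsym; have xQv : duality x (Q *m v) = duality (Q *m x) v.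
  by rewrite duality_trmx -Qsym.
rewrite /hamiltonian mulmxDr !dualityDr ![duality (x + v) _]dualityC !dualityDr.
rewrite [duality (Q *m x) x]dualityC ![duality (Q *m v) _]dualityC xQv.
by field.
Qed.

Definition phDAE_solution (D : set ('cV[R]_n * 'cV[R]_n)) Q I x : Prop :=
  forall t, t \in I ->
    derivable_within I x t /\ D (- derive_within I x t, Q *m x t).

(* The derivative of [lambda] is
   multiplied by zero in the block form (see [extended_blockE]), so that no
   regularity of [lambda] is required. *)
Definition extDAE_solution J G Q I x lambda : Prop :=
  forall t, t \in I ->
    [/\ derivable_within I x t,
        derive_within I x t = J *m Q *m x t + G *m lambda t
      & 0 = - G^T *m Q *m x t].

Lemma extended_blockE J G Q (x dx : 'cV[R]_n) (l dl : 'cV[R]_k) :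
  block_mx 1%:M 0 0 0 *m col_mx dx dl =
    block_mx J G (- G^T) 0 *m block_mx Q 0 0 1%:M *m col_mx x l
  <-> dx = J *m Q *m x + G *m l /\ (0 : 'cV[R]_k) = - G^T *m Q *m x.
Proof.
rewrite mulmx_block !mul_block_col !mulmx0 !mul0mx !mulmx1 !mul1mx.
rewrite !addr0 !add0r mul0mx addr0.
by split=> [/eq_col_mx //|[-> <-]].
Qed.

End PortHamiltonian.

(* Main.v *)
Require Import Defs.
From HB Require Import structures.
From mathcomp Require Import all_boot all_order all_algebra.
From mathcomp Require Import all_classical all_reals all_analysis.

Import Order.TTheory GRing.Theory Num.Theory.
Import numFieldNormedType.Exports.

Local Open Scope classical_set_scope.
Local Open Scope ring_scope.

(** At each fixed time, membership in [constraint_dirac J G] says exactly that some multiplier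
    satisfies the extended equations. One direction reads off [lambda t] as witness; the other picks
    a multiplier at each time by the axiom of choice, which suffices because [lambda] need not be
    regular. *)

Theorem mainTheorem4 (R : realType) (n k : nat)
    (Q J : 'M[R]_n) (G : 'M[R]_(n, k))
    (Qsym : Q = Q^T) (Jskew : J = - J^T) (Gfull : \rank G = minn n k)
    (I : interval R)
    (Inondeg : exists a b : R, [/\ a \in I, b \in I & a < b]) :
  (forall (x : R -> 'cV[R]_n) (lambda : R -> 'cV[R]_k),
      extDAE_solution J G Q I x lambda ->
      phDAE_solution (constraint_dirac J G) Q I x) /\
  (forall x : R -> 'cV[R]_n,
      phDAE_solution (constraint_dirac J G) Q I x ->
      exists lambda : R -> 'cV[R]_k, extDAE_solution J G Q I x lambda).
Proof.
split=> [x lambda sol t It | x sol].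
  have [dx xE Gx] := sol t It; split=> //; exists (lambda t); split=> /=.
    by rewrite opprK xE !mulmxA.
  by apply: oppr_inj; rewrite oppr0 mulmxA -!mulNmx.
(* The existential precedes [t \in I] so that [choice] gives a function on all of [R]; off [I] any
   witness works, here 0. *)
have pointwise t : exists l : 'cV[R]_k, t \in I ->
    derive_within I x t = J *m Q *m x t + G *m l.
  have [/sol[_ [l [/= xE _]]]|//] := boolP (t \in I); last by exists 0.
  by exists l; rewrite -mulmxA -xE opprK.
have [lambda lambdaE] := choice pointwise.
(* This [l] may differ from [lambda t]; only the constraint [Gx], free of multipliers, is used. *)
exists lambda => t It; have [dx [l [/= _ Gx]]] := sol t It.
by split; [|exact: lambdaE|rewrite -mulmxA mulNmx -Gx oppr0].
Qed.
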